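(* There exist uncountably many tangent functors $\mathrm{Dflg}_*^{loc}\to\mathrm{Vect}$ on diffeological spaces that are pairwise not naturally isomorphic.
   Context: Diffeological spaces. A parametrization of a set $X$ is a map $U\to X$ with $U$ an open subset of some $\mathbb{R}^n$, $n\ge 0$. A diffeology on $X$ is a set of parametrizations, called plots, such that: (Covering) every constant parametrization is a plot; (Locality) a parametrization $p:U\to X$ is a plot if $U$ has an open cover $\{U_i\}$ with every $p|_{U_i}$ a plot; (Smooth compatibility) if $p:U\to X$ is a plot, $V\subset\mathbb{R}^m$ is open and $f:V\to U$ is smooth, then $p\circ f$ is a plot. A diffeological space is a set with a diffeology. A map $f:X\to Y$ of diffeological spaces is smooth if $f\circ p$ is a plot of $Y$ for every plot $p$ of $X$. Smooth manifolds carry the standard diffeology (plots are the smooth maps from Euclidean open sets). The $D$-topology on $X$ is the finest topology making all plots continuous. Categories. $\mathrm{Dflg}_*^{loc}$ is the category whose objects are based diffeological spaces $(X,x)$ and whose morphisms are germs at the basepoint (with respect to the $D$-topology) of basepoint-preserving smooth maps. $\mathrm{Vect}$ is the category of real vector spaces and linear maps. $\mathrm{Eucl}_0^{loc}$ is the full subcategory of $\mathrm{Dflg}_*^{loc}$ on the pairs $(U,0)$ with $U$ an open subset of some $\mathbb{R}^n$ containing $0$ (it can equivalently be regarded as the full subcategory of based smooth manifolds). $T^{\mathrm{Eucl}_0^{loc}}:\mathrm{Eucl}_0^{loc}\to\mathrm{Vect}$ is the classical tangent functor $(U,0)\mapsto T_0(U)$, $f\mapsto df_0$. Tangent functor. A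 tangent functor is a functor $\mathrm{Dflg}_*^{loc}\to\mathrm{Vect}$ whose restriction to $\mathrm{Eucl}_0^{loc}$ is naturally isomorphic to $T^{\mathrm{Eucl}_0^{loc}}$. *)

(* Defs.v *)
From HB Require Import structures.
From mathcomp Require Import all_boot all_order all_algebra.
From mathcomp Require Import all_classical all_reals all_analysis.
Import Order.TTheory GRing.Theory Num.Theory.
Import numFieldNormedType.Exports.

Set Implicit Arguments.
Unset Strict Implicit.
Unset Printing Implicit Defensive.

Local Open Scope classical_set_scope.
Local Open Scope ring_scope.

Section Smooth.
Context {R : realType}.

Section Ck.
Context {V W : normedModType R}.

(* On a finite-dimensional [V] this is the usual class C^k: [f] and its iterated
   partial derivatives up to order [k] exist and are continuous on [U]. *)
Fixpoint Ck (k : nat) (U : set V) (f : V -> W) : Prop :=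
  if k is k'.+1 then
    (forall x, U x -> differentiable f x) /\ (forall v : V, Ck k' U ('D_v f))
  else forall x, U x -> {for x, continuous f}.

Definition smooth_on (U : set V) (f : V -> W) : Prop := forall k, Ck k U f.

End Ck.

Section CkTheory.
Context {V : normedModType R}.
Implicit Types (W : normedModType R) (U : set V).

Lemma near_eq_differentiable W (f g : V -> W) x :
  {near x, f =1 g} -> differentiable f x ->
  differentiable g x /\ 'd g x = 'd f x :> (V -> W).
Proof.
move=> fg df.
have fgx : f x = g x := nbhs_singleton fg.
have E : g \o shift x = cst (g x) + 'd f x +o_ 0 id.
  apply/eqaddoP => _/posnumP[e].
  have /eqaddoP/(_ e%:num (gt0 e)) := diff_locally df.
  have: \forall h \near 0, f (h + x) = g (h + x).
    have fg' : \forall y \near x, (f y = g y) by [].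
    move: fg'; rewrite (near_shift 0 x).
    by apply: filterS => h /=; rewrite subr0.
  apply: filterS2 => h /= fgh.
  by rewrite /= !fctE /= fgh fgx.
have dg : 'd g x = 'd f x :> (V -> W)
  by exact: (diff_unique (diff_continuous df) E).
split=> //; apply/diff_locallyP; rewrite dg; split=> //; exact: diff_continuous.
Qed.

Lemma Ck_ext W k U (f g : V -> W) : open U -> (forall x, U x -> f x = g x) ->
  Ck k U f -> Ck k U g.
Proof.
move=> oU; elim: k f g => [|k IH] f g fg /=.
  move=> cf x Ux; change (g @ x --> g x); rewrite -(fg _ Ux).
  apply: cvg_trans (cf x Ux); apply: near_eq_cvg.
  by apply: filterS (open_nbhs_nbhs (conj oU Ux)) => y /fg.
have nfg x : U x -> {near x, f =1 g}.
  by move=> Ux; apply: filterS (open_nbhs_nbhs (conj oU Ux)) => y /fg.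
move=> [df Df]; split => [x Ux|v].
  by have [] := near_eq_differentiable (nfg x Ux) (df x Ux).
apply: IH (Df v) => x Ux; exact: near_eq_derive (nfg x Ux).
Qed.

Lemma Ck_bigcup W k (C : set (set V)) (f : V -> W) :
  (forall U, C U -> Ck k U f) -> Ck k (\bigcup_(U in C) U) f.
Proof.
elim: k f => [|k IH] f /= CU; first by move=> x [U CUU]; apply: CU.
split=> [x [U CUU]|v]; first by apply: (CU U CUU).1.
by apply: IH => U /CU[].
Qed.

Lemma CkS W k U (f : V -> W) : Ck k.+1 U f -> Ck k U f.
Proof.
elim: k f => [|k IH] f; first by move=> [df _] x /df/differentiable_continuous.
by move=> [df Df]; split=> // v; apply/IH/Df.
Qed.

Lemma Ck_cst W k U (a : W) : Ck k U (cst a).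
Proof.
elim: k a => [|k IH] a /=; first by move=> x _; apply: cst_continuous.
split=> // v; rewrite (_ : 'D_v _ = cst 0); first exact: IH.
by apply/funext => x; rewrite derive_cst.
Qed.

Lemma Ck_lin W k U (f : {linear V -> W}) : continuous f -> Ck k U f.
Proof.
move=> cf; case: k => [|k]; first by move=> x _; apply: cf.
split=> [x _|v]; first exact: linear_differentiable.
rewrite (_ : 'D_v _ = cst (f v)); first exact: Ck_cst.
by apply/funext => x; rewrite deriveE ?diff_lin//; apply: linear_differentiable.
Qed.

Lemma Ck_id k U : Ck k U (@id V).
Proof. by apply: (@Ck_lin _ k U (@idfun V)) => x; apply: cvg_id. Qed.

Lemma CkD W k U (f g : V -> W) : open U -> Ck k U f -> Ck k U g ->
  Ck k U (f \+ g).
Proof.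
move=> oU; elim: k f g => [|k IH] f g /=.
  by move=> cf cg x Ux; apply: continuousD; [apply: cf|apply: cg].
move=> [df Df] [dg Dg]; split=> [x Ux|v].
  by apply: differentiableD; [apply: df|apply: dg].
apply: (Ck_ext oU _ (IH _ _ (Df v) (Dg v))) => x Ux.
by rewrite deriveD//; apply: diff_derivable; [apply: df|apply: dg].
Qed.

Lemma Ck_sum W k U n (f : 'I_n -> V -> W) : open U ->
  (forall i, Ck k U (f i)) -> Ck k U (fun x => \sum_i f i x).
Proof.
move=> oU fk; elim: n f fk => [|n IH] f fk.
  rewrite (_ : (fun _ => _) = cst 0); first exact: Ck_cst.
  by apply/funext => x; rewrite big_ord0.
rewrite (_ : (fun _ => _) =
    (fun x => \sum_(i < n) f (widen_ord (leqnSn n) i) x) \+ f ord_max).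
  by apply: CkD => //; apply: IH.
by apply/funext => x; rewrite big_ord_recr.
Qed.

Lemma scale_diff W (c : V -> R) (f : V -> W) x :
  differentiable c x -> differentiable f x ->
  differentiable (fun y => c y *: f y) x /\
  forall v, 'D_v (fun y => c y *: f y) x = c x *: 'D_v f x + 'D_v c x *: f x.
Proof.
have bil : bilinear_for (GRing.Scale.Law.clone _ _ *:%R _)
  (GRing.Scale.Law.clone _ _ *:%R _) (@GRing.scale R W : R -> W -> W).
  split=> [u' a y z|u a y z] /=; first by rewrite scalerDl scalerA.
  by rewrite scalerDr !scalerA mulrC.
pose BM := bilinear_isBilinear.Build R R W W _ _ _ bil.
pose B : {bilinear R -> W -> W} := HB.pack (@GRing.scale R W : R -> W -> W) BM.
move=> dc df.
have cB : continuous (fun p : R * W => B p.1 p.2).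
  by move=> p; apply: scale_continuous.
pose p y := (c y, f y).
have dp : differentiable p x by apply: differentiable_pair.
have dB : differentiable (fun p : R * W => B p.1 p.2) (p x).
  exact: differentiable_bilin.
have E : (fun y => c y *: f y) = (fun p : R * W => B p.1 p.2) \o p by [].
split=> [|v]; first by rewrite E; apply: differentiable_comp.
rewrite E deriveE; last exact: differentiable_comp.
rewrite diff_comp// [LHS]/= (diff_bilin (f := B) (p x) cB) diff_pair//=.
by rewrite !deriveE.
Qed.

Lemma CkZ W k U (c : V -> R) (f : V -> W) : open U -> Ck k U c -> Ck k U f ->
  Ck k U (fun x => c x *: f x).
Proof.
move=> oU; elim: k c f => [|k IH] c f.
  by move=> cc cf x Ux; apply: continuousZ; [apply: cc|apply: cf].
move=> Cc Cf; have := (CkS Cc, CkS Cf); move: Cc Cf => [dc Dc] [df Df] [Cc Cf].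
split=> [x Ux|v]; first by have [] := scale_diff (dc x Ux) (df x Ux).
apply: (Ck_ext oU _ (CkD oU (IH _ _ Cc (Df v)) (IH _ _ (Dc v) Cf))) => x Ux /=.
by have [_ ->] := scale_diff (dc x Ux) (df x Ux).
Qed.

Lemma Ck_lincomp W W' k U (L : {linear W -> W'}) (f : V -> W) : open U ->
  continuous L -> Ck k U f -> Ck k U (L \o f).
Proof.
move=> oU cL; elim: k f => [|k IH] f.
  by move=> cf x Ux; apply: continuous_comp; [apply: cf|apply: cL].
have dL y : differentiable L y by apply: linear_differentiable.
move=> [df Df]; split=> [x Ux|v].
  by apply: differentiable_comp; [apply: df|].
apply: (Ck_ext oU _ (IH _ (Df v))) => x Ux.
have dfx := df x Ux.
rewrite deriveE; last exact: differentiable_comp.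
by rewrite diff_comp//= diff_lin// deriveE.
Qed.

End CkTheory.

Lemma Ck_comp (V W : normedModType R) n k (U : set V) (U' : set 'rV[R]_n)
    (f : V -> 'rV[R]_n) (g : 'rV[R]_n -> W) : open U -> open U' ->
  f @` U `<=` U' -> Ck k U f -> Ck k U' g -> Ck k U (g \o f).
Proof.
move=> oU oU' fU; have fU' x : U x -> U' (f x).
  by move=> Ux; apply: fU; exists x.
elim: k g => [|k IH] g.
  move=> cf cg x Ux; apply: continuous_comp; first exact: cf.
  by apply: cg; apply: fU'.
move=> Cf; have := CkS Cf; case: Cf => df Df Cf [dg Dg].
have dgf x : U x -> differentiable (g \o f) x.
  by move=> Ux; apply: differentiable_comp; [apply: df|apply/dg/fU'].
split=> // v.
suff C : Ck k U (fun x => \sum_(i < n)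
    ('D_v f x) ord0 i *: ('D_(delta_mx ord0 i) g \o f) x).
  apply: (Ck_ext oU _ C) => x Ux.
  have dfx := df x Ux; have dgx := dg _ (fU' x Ux).
  rewrite [RHS]deriveE; last exact: dgf.
  rewrite diff_comp//= -(deriveE v dfx).
  rewrite [X in _ = 'd g (f x) X]row_sum_delta linear_sum.
  by apply: eq_bigr => i _; rewrite linearZ /= (deriveE _ dgx).
apply: (Ck_sum (f := fun i x =>
  ('D_v f x) ord0 i *: ('D_(delta_mx ord0 i) g \o f) x)) => // i.
apply: CkZ => //; last exact: (IH _ Cf (Dg _)).
have cL : continuous (fun M : 'rV[R]_n => M ord0 i) by apply: coord_continuous.
have linL : linear (fun M : 'rV[R]_n => M ord0 i).
  by move=> a M N; rewrite !mxE.
pose LM := GRing.isLinear.Build _ _ _ _ _ linL.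
pose L : {linear 'rV[R]_n -> R} := HB.pack (fun M : 'rV[R]_n => M ord0 i) LM.
exact: (Ck_lincomp (L := L) oU cL (Df v)).
Qed.

End Smooth.

(* A parametrization U -> X is represented by its open domain U and a total
   function on R^n; [plot_ext] says that only its values on U matter. *)
Record diffeology (R : realType) (X : Type) := Diffeology {
  plot : forall n : nat, set 'rV[R]_n -> ('rV[R]_n -> X) -> Prop;
  plot_open : forall n (U : set 'rV[R]_n) p, plot U p -> open U;
  plot_ext : forall n (U : set 'rV[R]_n) p q,
    (forall u, U u -> p u = q u) -> plot U p -> plot U q;
  plot_cst : forall n (U : set 'rV[R]_n) x, open U -> plot U (cst x);
  plot_local : forall n (U : set 'rV[R]_n) p (C : set (set 'rV[R]_n)),
    U = \bigcup_(V in C) V -> (forall V, C V -> plot V p) -> plot U p;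
  plot_comp : forall n m (U : set 'rV[R]_n) p (V : set 'rV[R]_m) f,
    plot U p -> open V -> smooth_on V f -> f @` V `<=` U -> plot V (p \o f) }.

Section Diffeology.
Context {R : realType}.

Lemma plot_sub X (D : diffeology R X) n (U V : set 'rV[R]_n) p :
  plot D U p -> open V -> V `<=` U -> plot D V p.
Proof.
move=> Dp oV VU; apply: (plot_comp (f := @id 'rV[R]_n) Dp oV).
  by move=> k; apply: Ck_id.
by move=> _ [x /VU ? <-].
Qed.

(* The D-topology: the finest one for which every plot is continuous. *)
Definition D_open X (D : diffeology R X) (A : set X) : Prop :=
  forall n (U : set 'rV[R]_n) p, plot D U p -> open (U `&` p @^-1` A).

Section DTopology.
Variables (X : Type) (D : diffeology R X).

Lemma D_openT : D_open D setT.
Proof. by move=> n U p Dp; rewrite preimage_setT setIT; apply: plot_open Dp. Qed.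

Lemma D_openI A B : D_open D A -> D_open D B -> D_open D (A `&` B).
Proof.
move=> oA oB n U p Dp; rewrite preimage_setI -(setIid U) setIACA.
by apply: openI; [apply: oA|apply: oB].
Qed.

Lemma D_open_bigcup I (P : set I) (A : I -> set X) :
  (forall i, P i -> D_open D (A i)) -> D_open D (\bigcup_(i in P) A i).
Proof.
move=> oA n U p Dp; rewrite preimage_bigcup setI_bigcupr.
by apply: bigcup_open => i /oA; apply.
Qed.

Lemma D_open_finest (O : set (set X)) :
  (forall n (U : set 'rV[R]_n) p, plot D U p ->
     forall A, O A -> open (U `&` p @^-1` A)) -> O `<=` D_open D.
Proof. by move=> Oc A OA n U p Dp; apply: Oc. Qed.

End DTopology.

(* Smoothness of the restriction of [f] to [A], for the subspace diffeology. *)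
Definition dsmooth_on X Y (DX : diffeology R X) (DY : diffeology R Y)
    (A : set X) (f : X -> Y) : Prop :=
  forall n (U : set 'rV[R]_n) p, plot DX U p -> p @` U `<=` A ->
    plot DY U (f \o p).

Lemma D_open_preim X Y (DX : diffeology R X) (DY : diffeology R Y) A f B :
  D_open DX A -> dsmooth_on DX DY A f -> D_open DY B ->
  D_open DX (A `&` f @^-1` B).
Proof.
move=> oA sf oB n U p Dp; rewrite preimage_setI setIA.
apply: (oB _ _ (f \o p)); apply: sf; last by move=> _ [u [_ Au] <-].
by apply: plot_sub (Dp) (oA _ _ _ Dp) _; apply: subIsetl.
Qed.

End Diffeology.

Record based_space (R : realType) := BasedSpace {
  bcarrier :> Type;
  bdiff : diffeology R bcarrier;
  bpoint : bcarrier }.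

(* A basepoint-preserving smooth map ldom -> Y, with [ldom] a D-open
   neighbourhood of the basepoint; the values of [lfun] outside of [ldom] are
   irrelevant, as they do not affect the germ. *)
Record local_map (R : realType) (X Y : based_space R) := LocalMap {
  ldom : set X;
  lfun :> X -> Y;
  ldom_open : D_open (bdiff X) ldom;
  ldom_base : ldom (bpoint X);
  lfun_smooth : dsmooth_on (bdiff X) (bdiff Y) ldom lfun;
  lfun_base : lfun (bpoint X) = bpoint Y }.

Arguments ldom_open {R X Y} l.
Arguments ldom_base {R X Y} l.
Arguments lfun_smooth {R X Y} l.

Section Germs.
Context {R : realType}.
Implicit Types X Y Z : based_space R.

Definition same_germ X Y (f g : local_map X Y) : Prop :=
  exists A : set X, [/\ D_open (bdiff X) A, A (bpoint X),
    A `<=` ldom f `&` ldom g & forall x, A x -> f x = g x].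

Lemma same_germ_refl X Y :
  reflexive (fun f g : local_map X Y => `[< same_germ f g >]).
Proof.
move=> f; apply/asboolP; exists (ldom f).
by split=> //; [apply: ldom_open|apply: ldom_base].
Qed.

Lemma same_germ_sym X Y :
  symmetric (fun f g : local_map X Y => `[< same_germ f g >]).
Proof.
suff H (f g : local_map X Y) : same_germ f g -> same_germ g f.
  by move=> f g; apply/asboolP/asboolP; apply: H.
by move=> [A [oA Ax sA fg]]; exists A; split=> //; [rewrite setIC|move=> x /fg].
Qed.

Lemma same_germ_trans X Y :
  transitive (fun f g : local_map X Y => `[< same_germ f g >]).
Proof.
move=> g f h /asboolP[A [oA Ax sA fg]] /asboolP[B [oB Bx sB gh]].
apply/asboolP; exists (A `&` B); split=> //; first exact: D_openI.
  by move=> x [/sA[? _] /sB[_ ?]].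
by move=> x [/fg -> /gh].
Qed.

HB.instance Definition _ X Y := gen_eqMixin (local_map X Y).
HB.instance Definition _ X Y := gen_choiceMixin (local_map X Y).

Definition germ_rel X Y : equiv_rel (local_map X Y) :=
  EquivRel _ (@same_germ_refl X Y) (@same_germ_sym X Y) (@same_germ_trans X Y).

Definition germ X Y : Type := {eq_quot germ_rel X Y}%qT.

Definition germ_of X Y (f : local_map X Y) : germ X Y :=
  (\pi_{eq_quot germ_rel X Y} f)%qT.

Definition germ_repr X Y (f : germ X Y) : local_map X Y :=
  repr (f : {eq_quot germ_rel X Y}%qT).

Lemma germ_reprK X Y (f : germ X Y) : germ_of (germ_repr f) = f.
Proof. exact: reprK. Qed.

Lemma germ_ofP X Y (f g : local_map X Y) :
  germ_of f = germ_of g <-> same_germ f g.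
Proof.
split=> [/eqmodP/asboolP //|fg].
by apply/eqmodP; apply/asboolP.
Qed.

Lemma germ_repr_of X Y (f : local_map X Y) : same_germ (germ_repr (germ_of f)) f.
Proof. by apply/germ_ofP; rewrite germ_reprK. Qed.

Fact local_id_smooth X : dsmooth_on (bdiff X) (bdiff X) setT id.
Proof. by []. Qed.

Definition local_id X : local_map X X :=
  LocalMap (@D_openT R X (bdiff X)) I (@local_id_smooth X) erefl.

Section LocalComp.
Variables (X Y Z : based_space R) (g : local_map Y Z) (f : local_map X Y).

Let dom := ldom f `&` f @^-1` ldom g.

Fact local_comp_open : D_open (bdiff X) dom.
Proof.
apply: D_open_preim; first exact: ldom_open.
  exact: lfun_smooth.
exact: ldom_open.
Qed.

Fact local_comp_dom_base : dom (bpoint X).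
Proof.
split; first exact: ldom_base.
by rewrite /= lfun_base; apply: ldom_base.
Qed.

Fact local_comp_smooth : dsmooth_on (bdiff X) (bdiff Z) dom (g \o f).
Proof.
move=> n U p Dp sub; rewrite -compA.
apply: lfun_smooth; first by apply: lfun_smooth => // x /sub[].
by move=> _ [u Uu <-]; have [] := sub _ (imageP p Uu).
Qed.

Fact local_comp_base : (g \o f) (bpoint X) = bpoint Z.
Proof. by rewrite /= !lfun_base. Qed.

Definition local_comp : local_map X Z :=
  LocalMap local_comp_open local_comp_dom_base local_comp_smooth local_comp_base.

End LocalComp.

Lemma same_germ_comp X Y Z (g g' : local_map Y Z) (f f' : local_map X Y) :
  same_germ g g' -> same_germ f f' ->
  same_germ (local_comp g f) (local_comp g' f').
Proof.
move=> [B [oB By sB gg]] [A [oA Ax sA ff]].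
exists (A `&` (ldom f `&` f @^-1` B)); split.
- apply: D_openI => //; apply: D_open_preim oB; first exact: ldom_open.
  exact: lfun_smooth.
- split=> //; split; first exact: ldom_base.
  by rewrite /= lfun_base.
- move=> x [Ax' [fx /= Bfx]]; have [? ?] := sA _ Ax'; have [? ?] := sB _ Bfx.
  by split; split=> //=; rewrite -(ff x Ax').
- by move=> x [Ax' [_ /= Bfx]]; rewrite -(ff x Ax') gg.
Qed.

Definition germ_id X : germ X X := germ_of (local_id X).

Definition germ_comp X Y Z (g : germ Y Z) (f : germ X Y) : germ X Z :=
  germ_of (local_comp (germ_repr g) (germ_repr f)).

Lemma germ_compE X Y Z (g : local_map Y Z) (f : local_map X Y) :
  germ_comp (germ_of g) (germ_of f) = germ_of (local_comp g f).
Proof. by apply/germ_ofP/same_germ_comp; apply: germ_repr_of. Qed.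

Lemma same_germ_eq X Y (f g : local_map X Y) : f =1 g -> same_germ f g.
Proof.
move=> fg; exists (ldom f `&` ldom g); split=> //.
- by apply: D_openI; apply: ldom_open.
- by split; apply: ldom_base.
Qed.

Lemma germ_compA X Y Z T (h : germ Z T) (g : germ Y Z) (f : germ X Y) :
  germ_comp h (germ_comp g f) = germ_comp (germ_comp h g) f.
Proof.
rewrite -(germ_reprK h) -(germ_reprK g) -(germ_reprK f) !germ_compE.
exact/germ_ofP/same_germ_eq.
Qed.

Lemma germ_comp1l X Y (f : germ X Y) : germ_comp (germ_id Y) f = f.
Proof.
by rewrite -(germ_reprK f) germ_compE; apply/germ_ofP/same_germ_eq.
Qed.

Lemma germ_comp1r X Y (f : germ X Y) : germ_comp f (germ_id X) = f.
Proof.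
by rewrite -(germ_reprK f) germ_compE; apply/germ_ofP/same_germ_eq.
Qed.

End Germs.

Record category := Category {
  ob :> Type;
  hom : ob -> ob -> Type;
  idm : forall X, hom X X;
  compm : forall X Y Z, hom Y Z -> hom X Y -> hom X Z;
  compmA : forall X Y Z T (h : hom Z T) (g : hom Y Z) (f : hom X Y),
    compm h (compm g f) = compm (compm h g) f;
  compm1l : forall X Y (f : hom X Y), compm (idm Y) f = f;
  compm1r : forall X Y (f : hom X Y), compm f (idm X) = f }.

Arguments idm {c} X.

Record functor (C D : category) := Functor {
  fob :> C -> D;
  fmap : forall X Y : C, hom X Y -> hom (fob X) (fob Y);
  fmap1 : forall X : C, fmap (idm X) = idm (fob X);
  fmapM : forall (X Y Z : C) (g : hom Y Z) (f : hom X Y),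
    fmap (compm g f) = compm (fmap g) (fmap f) }.

Record nat_trans (C D : category) (F G : functor C D) := NatTrans {
  ntapp :> forall X : C, hom (F X) (G X);
  ntapp_natural : forall (X Y : C) (f : hom X Y),
    compm (ntapp Y) (fmap F f) = compm (fmap G f) (ntapp X) }.

Definition is_iso (C : category) (X Y : C) (f : hom X Y) : Prop :=
  exists g : hom Y X, compm g f = idm X /\ compm f g = idm Y.

Definition naturally_isomorphic (C D : category) (F G : functor C D) : Prop :=
  exists eta : nat_trans F G, forall X, is_iso (eta X).

(* Indexing the objects by [I] keeps access to the data behind [i a], such as
   the dimension of a Euclidean domain. *)
Definition full_subcategory (C : category) (I : Type) (i : I -> C) : category :=
  @Category I (fun a b => hom (i a) (i b)) (fun a => idm (i a))
    (fun a b c => @compm C (i a) (i b) (i c))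
    (fun a b c d => @compmA C (i a) (i b) (i c) (i d))
    (fun a b => @compm1l C (i a) (i b)) (fun a b => @compm1r C (i a) (i b)).

Definition functor_restr (C D : category) (I : Type) (i : I -> C)
    (F : functor C D) : functor (full_subcategory i) D :=
  @Functor (full_subcategory i) D (fun a => F (i a))
    (fun a b f => fmap F (f : hom (i a) (i b)))
    (fun a => fmap1 F (i a))
    (fun a b c g f => fmapM F (g : hom (i b) (i c)) (f : hom (i a) (i b))).

Definition Dflg_loc (R : realType) : category :=
  @Category (based_space R) (@germ R) (@germ_id R) (@germ_comp R)
    (@germ_compA R) (@germ_comp1l R) (@germ_comp1r R).

Section Vect.
Variable R : realType.
Implicit Types U V W X : lmodType R.

Lemma linear_eq U V (f g : {linear U -> V}) : f =1 g -> f = g.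
Proof.
case: f g => [f cf] [g cg] /= /funext fg; rewrite {}fg in cf *.
by congr GRing.Linear.Pack; case: cf cg => [[a] [b]] [[a'] [b']];
  rewrite (Prop_irrelevance a a') (Prop_irrelevance b b').
Qed.

Definition lin_id U : {linear U -> U} := @idfun U.

Definition lin_comp U V W (g : {linear V -> W}) (f : {linear U -> V}) :
  {linear U -> W} := g \o f.

Lemma lin_compA U V W X (h : {linear W -> X}) (g : {linear V -> W})
    (f : {linear U -> V}) : lin_comp h (lin_comp g f) = lin_comp (lin_comp h g) f.
Proof. exact: linear_eq. Qed.

Lemma lin_comp1l U V (f : {linear U -> V}) : lin_comp (lin_id V) f = f.
Proof. exact: linear_eq. Qed.

Lemma lin_comp1r U V (f : {linear U -> V}) : lin_comp f (lin_id U) = f.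
Proof. exact: linear_eq. Qed.

Definition Vect : category :=
  @Category (lmodType R) (fun U V => {linear U -> V}) lin_id lin_comp
    lin_compA lin_comp1l lin_comp1r.

End Vect.

Record eucl_domain (R : realType) := EuclDomain {
  edim : nat;
  edom : set 'rV[R]_edim;
  edom_open : open edom;
  edom0 : edom 0 }.

Arguments edom {R} e _.
Arguments edom_open {R} e.
Arguments edom0 {R} e.

Section Euclidean.
Context {R : realType}.

Section Standard.
Variables (n : nat) (U : set 'rV[R]_n).

Definition std_plot m (V : set 'rV[R]_m) (p : 'rV[R]_m -> U) : Prop :=
  open V /\ smooth_on V (val \o p).

Lemma std_plot_ext m (V : set 'rV[R]_m) p q :
  (forall u, V u -> p u = q u) -> std_plot V p -> std_plot V q.
Proof.
move=> pq [oV sp]; split=> // k; apply: Ck_ext oV _ (sp k) => x Vx /=.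
by rewrite pq.
Qed.

Lemma std_plot_cst m (V : set 'rV[R]_m) x : open V -> std_plot V (cst x).
Proof. by move=> oV; split=> // k; apply: Ck_cst. Qed.

Lemma std_plot_local m (V : set 'rV[R]_m) p (C : set (set 'rV[R]_m)) :
  V = \bigcup_(W in C) W -> (forall W, C W -> std_plot W p) -> std_plot V p.
Proof.
move=> -> Cp; split; first by apply: bigcup_open => W /Cp[].
by move=> k; apply: Ck_bigcup => W /Cp[_]; apply.
Qed.

Lemma std_plot_comp m l (V : set 'rV[R]_m) p (W : set 'rV[R]_l) f :
  std_plot V p -> open W -> smooth_on W f -> f @` W `<=` V ->
  std_plot W (p \o f).
Proof.
move=> [oV sp] oW sf fW; split=> // k; rewrite compA.
exact: Ck_comp oW oV fW (sf k) (sp k).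
Qed.

Definition std_diffeology : diffeology R U :=
  @Diffeology R U std_plot (fun _ _ _ => @proj1 _ _) std_plot_ext std_plot_cst
    std_plot_local std_plot_comp.

End Standard.

Definition eucl_base (U : eucl_domain R) : edom U :=
  exist _ 0 (mem_set (edom0 U)).

Definition eucl_space (U : eucl_domain R) : Dflg_loc R :=
  BasedSpace (std_diffeology (edom U)) (eucl_base U).

Definition Eucl_loc : category := full_subcategory eucl_space.

(* [f] as a map between vector spaces, in order to differentiate it at 0. *)
Definition eucl_fun (U V : eucl_domain R)
    (f : local_map (eucl_space U) (eucl_space V)) (x : 'rV[R]_(edim U)) :
    'rV[R]_(edim V) :=
  val (f (insubd (eucl_base U) x)).

Definition eucl_diff (U V : eucl_domain R)
    (f : germ (eucl_space U) (eucl_space V)) :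
    {linear 'rV[R]_(edim U) -> 'rV[R]_(edim V)} :=
  'd (eucl_fun (germ_repr f)) (0 : 'rV[R]_(edim U)).

Lemma eucl_fun0 (U V : eucl_domain R)
    (f : local_map (eucl_space U) (eucl_space V)) :
  eucl_fun f 0 = 0.
Proof.
rewrite /eucl_fun (_ : insubd _ _ = eucl_base U); last first.
  by rewrite -[0 in LHS]/(val (eucl_base U)) valKd.
by rewrite [f _](lfun_base f).
Qed.

Lemma insubd_plot (U : eucl_domain R) :
  plot (bdiff (eucl_space U)) (edom U) (insubd (eucl_base U)).
Proof.
split; first exact: edom_open.
move=> k; apply: (Ck_ext (edom_open U) _ (Ck_id k (edom U))) => x Ux /=.
by rewrite insubdK//; apply/mem_set.
Qed.

Lemma eucl_nbhs0 (U : eucl_domain R) (A : set (eucl_space U)) :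
  D_open (bdiff (eucl_space U)) A -> A (eucl_base U) ->
  nbhs (0 : 'rV[R]_(edim U)) (edom U `&` insubd (eucl_base U) @^-1` A).
Proof.
move=> oA A0; apply: open_nbhs_nbhs; split; first exact: oA (insubd_plot U).
split; first exact: edom0.
by rewrite /= -[0]/(val (eucl_base U)) valKd.
Qed.

Lemma eucl_fun_differentiable (U V : eucl_domain R)
    (f : local_map (eucl_space U) (eucl_space V)) :
  differentiable (eucl_fun f) (0 : 'rV[R]_(edim U)).
Proof.
pose W := edom U `&` insubd (eucl_base U) @^-1` ldom f.
have nW : nbhs _ W := eucl_nbhs0 (ldom_open f) (ldom_base f).
have oW : open W := ldom_open f _ _ _ (insubd_plot U).
have pW : plot (bdiff (eucl_space U)) W (insubd (eucl_base U)).
  by apply: plot_sub (insubd_plot U) oW _; apply: subIsetl.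
have [|_ /(_ 1%N)[df _]] := lfun_smooth f _ _ _ pW.
  by move=> _ [x [_ ?] <-].
by apply: df; apply: nbhs_singleton nW.
Qed.

Lemma same_germ_diff (U V : eucl_domain R)
    (f g : local_map (eucl_space U) (eucl_space V)) : same_germ f g ->
  'd (eucl_fun f) 0 = 'd (eucl_fun g) 0 :> ('rV[R]_(edim U) -> 'rV[R]_(edim V)).
Proof.
move=> [A [oA A0 _ fg]].
have nfg : {near (0 : 'rV[R]_(edim U)), eucl_fun g =1 eucl_fun f}.
  by apply: filterS (eucl_nbhs0 oA A0) => x [_ Ax]; rewrite /eucl_fun fg.
exact: (near_eq_differentiable nfg (eucl_fun_differentiable g)).2.
Qed.

Lemma eucl_diff_of (U V : eucl_domain R)
    (f : local_map (eucl_space U) (eucl_space V)) :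
  eucl_diff (germ_of f) = 'd (eucl_fun f) 0
    :> ('rV[R]_(edim U) -> 'rV[R]_(edim V)).
Proof. exact/same_germ_diff/germ_repr_of. Qed.

Lemma eucl_diff1 (U : eucl_domain R) :
  eucl_diff (germ_id (eucl_space U)) = lin_id 'rV[R]_(edim U).
Proof.
apply: linear_eq => v; rewrite eucl_diff_of.
have nid : {near (0 : 'rV[R]_(edim U)),
    id =1 eucl_fun (local_id (eucl_space U))}.
  apply: filterS (open_nbhs_nbhs (conj (edom_open U) (edom0 U))) => x Ux.
  by rewrite /eucl_fun /= insubdK//; apply/mem_set.
have [|_ ->] := near_eq_differentiable nid; first exact: ex_diff.
by rewrite diff_val.
Qed.

Lemma eucl_diffM (U V W : eucl_domain R)
    (g : germ (eucl_space V) (eucl_space W))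
    (f : germ (eucl_space U) (eucl_space V)) :
  eucl_diff (germ_comp g f) = lin_comp (eucl_diff g) (eucl_diff f).
Proof.
apply: linear_eq => v; rewrite -(germ_reprK g) -(germ_reprK f) germ_compE /=.
rewrite !eucl_diff_of.
have -> : eucl_fun (local_comp (germ_repr g) (germ_repr f)) =
    eucl_fun (germ_repr g) \o eucl_fun (germ_repr f).
  by apply/funext => x; rewrite /eucl_fun /= valKd.
rewrite diff_comp ?eucl_fun0//; exact: eucl_fun_differentiable.
Qed.

(* The tangent space T_0 U of an open subset U of R^n is identified with R^n. *)
Definition T_Eucl : functor Eucl_loc (Vect R) :=
  @Functor Eucl_loc (Vect R) (fun U => 'rV[R]_(edim U)) eucl_diff eucl_diff1
    eucl_diffM.

Definition tangent_functor (F : functor (Dflg_loc R) (Vect R)) : Prop :=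
  naturally_isomorphic (functor_restr eucl_space F) T_Eucl.

End Euclidean.

(* Main.v *)
Require Import Defs.
From mathcomp Require Import all_boot all_order all_algebra.
From mathcomp Require Import all_classical all_reals all_analysis.
From HB Require Import structures.
Import Order.TTheory GRing.Theory Num.Theory.
Import numFieldNormedType.Exports.

(* The right Kan extension of the classical tangent functor along the full
   inclusion of Eucl_0^loc restricts to it. Adding to it the maps from the germs
   X -> S into a vector space V that vanish on the germs factoring through a
   Euclidean space changes nothing on Euclidean spaces, for any fixed S. For S the
   indiscrete space with two points, all germs S -> E into Euclidean spaces are
   constant and the only germs S -> S are the identity and the constant one, so
   that the resulting functor T_V satisfies T_V(S) = V. Since V is arbitrary,
   countably many isomorphism classes cannot suffice, by Cantor's theorem. *)

Set Implicit Arguments.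
Unset Strict Implicit.
Unset Printing Implicit Defensive.

Local Open Scope classical_set_scope.
Local Open Scope ring_scope.
Local Obligation Tactic := idtac.

(** * Germs at the indiscrete two-point space *)

Section IndiscreteSpace.
Context {R : realType}.

Section Indiscrete.
Variable X : Type.

Definition indiscrete_plot n (U : set 'rV[R]_n) (p : 'rV[R]_n -> X) : Prop :=
  open U.

Lemma indiscrete_plot_local n (U : set 'rV[R]_n) (p : 'rV[R]_n -> X)
    (C : set (set 'rV[R]_n)) :
  U = \bigcup_(V in C) V -> (forall V, C V -> indiscrete_plot V p) ->
  indiscrete_plot U p.
Proof. by move=> -> Cp; apply: bigcup_open => V /Cp. Qed.

Definition indiscrete : diffeology R X :=
  @Diffeology R X indiscrete_plot (fun _ _ _ => id) (fun _ _ _ _ _ => id)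
    (fun _ _ _ => id) indiscrete_plot_local (fun _ _ _ _ _ _ _ oV _ _ => oV).

(** Every map is a plot, including the one on the line sending 0 to [x] and all other points to [y].
    If [A] contained [x] but not [y], its preimage would be the single point 0, which is not
    open. *)
Lemma D_open_indiscrete (A : set X) x y : D_open indiscrete A -> A x -> A y.
Proof.
move=> oA Ax; apply: contrapT => nAy.
pose p (u : 'rV[R]_1) := if `[< u = 0 >] then x else y.
have o0 : open (setT `&` p @^-1` A) by apply: oA; apply: openT.
have Ap u : (p @^-1` A) u -> u = 0.
  by rewrite /preimage /= /p; case: asboolP.
have n0 : nbhs (0 : 'rV[R]_1) (p @^-1` A).
  rewrite setTI in o0; apply: open_nbhs_nbhs; split=> //=.
  by rewrite /preimage /= /p; case: asboolP.
have /nbhs_ballP[e /= e0 be] := n0.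
(* This vector lies in the ball of radius [e] around 0, hence in the preimage, although it is
   nonzero. *)
have : const_mx (e / 2) = 0 :> 'rV[R]_1.
  apply: Ap; apply: be; split=> // i j; rewrite !mxE /ball /= sub0r normrN.
  by rewrite gtr0_norm ?divr_gt0// ltr_pdivrMr// mulr_natr mulr2n ltrDl.
move=> /matrixP/(_ ord0 ord0); rewrite !mxE => /eqP.
by rewrite gt_eqF ?divr_gt0.
Qed.

End Indiscrete.

Definition two_points : Dflg_loc R := BasedSpace (indiscrete bool) true.

Section ConstantGerm.
Variables X Y : based_space R.

Fact cst_smooth : dsmooth_on (bdiff X) (bdiff Y) setT (cst (bpoint Y)).
Proof. by move=> n U p Dp _; apply: plot_cst; apply: plot_open Dp. Qed.

Definition cst_map : local_map X Y :=
  LocalMap (@D_openT R X (bdiff X)) I cst_smooth erefl.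

Definition cst_germ : germ X Y := germ_of cst_map.

End ConstantGerm.

Lemma cst_germ_comp X Y Z : germ_comp (cst_germ Y Z) (cst_germ X Y) = cst_germ X Z.
Proof. by rewrite germ_compE; apply/germ_ofP/same_germ_eq. Qed.

(** Plots of a Euclidean domain are continuous, and points are closed in the Hausdorff space R^n. *)
Lemma D_open_neq (E : eucl_domain R) (c : eucl_space E) :
  D_open (bdiff (eucl_space E)) [set x | x <> c].
Proof.
move=> n U p [oU /(_ 0%N) cp].
rewrite openE => u [Uu /= puc].
have : nbhs (val (p u)) [set y | y <> val c].
  apply: open_nbhs_nbhs; split; last first.
    by move=> /= e; exact/puc/val_inj.
  have := @norm_hausdorff _ 'rV[R]_(edim E).
  by move=> /hausdorff_accessible/accessible_closed_set1/(_ (val c))/closed_openC.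
move=> /(cp u Uu) nu.
have {}nu : nbhs u [set v | val (p v) <> val c] by exact: nu.
apply: filterI; first exact: open_nbhs_nbhs.
by apply: (filterS _ nu) => v /= vc pv; apply: vc; congr val.
Qed.

(** If [f false] differed from the basepoint, the preimage of the complement of [f false] would be a
    D-open set containing [true] but not [false]. *)
Lemma germ_two_points_eucl (E : eucl_domain R)
    (f : germ two_points (eucl_space E)) : f = cst_germ two_points (eucl_space E).
Proof.
rewrite -(germ_reprK f); move: (germ_repr f) => {}f.
apply/germ_ofP/same_germ_eq; case=> /=; first exact: (lfun_base f).
apply: contrapT => /= f0.
have f0' : bpoint (eucl_space E) <> f false by move=> e; apply: f0; rewrite -e.
have oA := D_open_preim (ldom_open f) (lfun_smooth f) (@D_open_neq E (f false)).
have [|_ //] := @D_open_indiscrete bool _ true false oA.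
by split; [exact: (ldom_base f)|rewrite /preimage /= (lfun_base f)].
Qed.

Definition eucl_pt : eucl_domain R :=
  @EuclDomain R 0 setT openT I.

(** Factoring through R^0, whose tangent space is zero, is what makes both parts of a tangent vector
    vanish on constant germs into Euclidean spaces and into [two_points]. *)
Lemma cst_germ_factor X Y : exists (h : germ (eucl_space eucl_pt) Y)
  (f : germ X (eucl_space eucl_pt)), cst_germ X Y = germ_comp h f.
Proof. by exists (cst_germ _ _), (cst_germ _ _); rewrite cst_germ_comp. Qed.

Lemma germ_two_points (g : germ two_points two_points) :
  g = germ_id two_points \/ g = cst_germ two_points two_points.
Proof.
rewrite -(germ_reprK g); move: (germ_repr g) => {}g.
case E : (g false); [right|left];
  apply/germ_ofP/same_germ_eq => -[] //=; exact: (lfun_base g).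
Qed.

(** The composite is constant, and a neighbourhood on which it agreed with the identity would
    contain [false]. *)
Lemma eucl_factor_neq_id (E : eucl_domain R) (h : germ (eucl_space E) two_points)
    (f : germ two_points (eucl_space E)) : germ_comp h f <> germ_id two_points.
Proof.
rewrite (germ_two_points_eucl f) -(germ_reprK h); move: (germ_repr h) => {}h.
rewrite germ_compE => /germ_ofP[A [oA A0 _ hA]].
have Af : A false by exact: (D_open_indiscrete (x := true) _ oA A0).
by have := hA _ Af; rewrite /= (lfun_base h).
Qed.

End IndiscreteSpace.

(** * The functor attached to a vector space [V] *)

Section ExtendedTangent.
Context {R : realType}.
Variable V : lmodType R.

(* [eucl_part] ranges over the right Kan extension, written as the limit of the
   T_0 E over all germs X -> E. *)
Record tvec (X : based_space R) := TVec {
  eucl_part : forall E : eucl_domain R,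
    germ X (eucl_space E) -> 'rV[R]_(edim E);
  extra_part : germ X two_points -> V;
  eucl_partM : forall (E E' : eucl_domain R)
    (g : germ (eucl_space E) (eucl_space E')) (f : germ X (eucl_space E)),
    eucl_part (germ_comp g f) = eucl_diff g (eucl_part f);
  extra_part0 : forall (E : eucl_domain R) (h : germ (eucl_space E) two_points)
    (f : germ X (eucl_space E)), extra_part (germ_comp h f) = 0 }.

Lemma tvec_eq X (u v : tvec X) :
  (forall E (f : germ X (eucl_space E)), eucl_part u f = eucl_part v f) ->
  (forall g, extra_part u g = extra_part v g) -> u = v.
Proof.
case: u v => [u1 u2 h1 h2] [v1 v2 k1 k2] /= e1 e2.
have e1' : u1 = v1 by apply: functional_extensionality_dep => E; apply/funext/e1.
have e2' : u2 = v2 by apply/funext/e2.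
by subst v1 v2; rewrite (Prop_irrelevance h1 k1) (Prop_irrelevance h2 k2).
Qed.

HB.instance Definition _ X := gen_eqMixin (tvec X).
HB.instance Definition _ X := gen_choiceMixin (tvec X).

Section Module.
Variable X : based_space R.
Implicit Types u v w : tvec X.

Program Definition tvec0 : tvec X :=
  @TVec X (fun _ _ => 0) (fun _ => 0) _ _.
Next Obligation. by move=> E E' g f /=; rewrite linear0. Qed.
Next Obligation. by []. Qed.

Program Definition tvec_opp u : tvec X :=
  @TVec X (fun E f => - eucl_part u f) (fun g => - extra_part u g) _ _.
Next Obligation. by move=> u E E' g f /=; rewrite eucl_partM linearN. Qed.
Next Obligation. by move=> u E h f /=; rewrite extra_part0 oppr0. Qed.

Program Definition tvec_add u v : tvec X :=
  @TVec X (fun E f => eucl_part u f + eucl_part v f)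
    (fun g => extra_part u g + extra_part v g) _ _.
Next Obligation. by move=> u v E E' g f /=; rewrite !eucl_partM linearD. Qed.
Next Obligation. by move=> u v E h f /=; rewrite !extra_part0 addr0. Qed.

Program Definition tvec_scale (a : R) u : tvec X :=
  @TVec X (fun E f => a *: eucl_part u f) (fun g => a *: extra_part u g) _ _.
Next Obligation. by move=> a u E E' g f /=; rewrite eucl_partM linearZ. Qed.
Next Obligation. by move=> a u E h f /=; rewrite extra_part0 scaler0. Qed.

Fact tvec_addA : associative tvec_add.
Proof. by move=> u v w; apply: tvec_eq => *; apply: addrA. Qed.

Fact tvec_addC : commutative tvec_add.
Proof. by move=> u v; apply: tvec_eq => *; apply: addrC. Qed.

Fact tvec_add0 : left_id tvec0 tvec_add.
Proof. by move=> u; apply: tvec_eq => *; apply: add0r. Qed.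

Fact tvec_addN : left_inverse tvec0 tvec_opp tvec_add.
Proof. by move=> u; apply: tvec_eq => *; apply: addNr. Qed.

HB.instance Definition _ :=
  GRing.isZmodule.Build (tvec X) tvec_addA tvec_addC tvec_add0 tvec_addN.

Fact tvec_scaleA a b v : tvec_scale a (tvec_scale b v) = tvec_scale (a * b) v.
Proof. by apply: tvec_eq => *; apply: scalerA. Qed.

Fact tvec_scale1 : left_id 1 tvec_scale.
Proof. by move=> u; apply: tvec_eq => *; apply: scale1r. Qed.

Fact tvec_scaleDr : right_distributive tvec_scale +%R.
Proof. by move=> a u v; apply: tvec_eq => *; apply: scalerDr. Qed.

Fact tvec_scaleDl v : {morph tvec_scale^~ v : a b / a + b}.
Proof. by move=> a b; apply: tvec_eq => *; apply: scalerDl. Qed.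

HB.instance Definition _ := GRing.Zmodule_isLmodule.Build R (tvec X)
  tvec_scaleA tvec_scale1 tvec_scaleDr tvec_scaleDl.

End Module.

Section Push.
Variables (X Y : based_space R) (f : germ X Y).

Program Definition push (u : tvec X) : tvec Y :=
  @TVec Y (fun E g => eucl_part u (germ_comp g f))
    (fun g => extra_part u (germ_comp g f)) _ _.
Next Obligation. by move=> u E E' g h /=; rewrite -germ_compA eucl_partM. Qed.
Next Obligation. by move=> u E g h /=; rewrite -germ_compA extra_part0. Qed.

Fact push_linear : linear push.
Proof. by move=> a u v; apply: tvec_eq. Qed.

HB.instance Definition _ := GRing.isLinear.Build _ _ _ _ push push_linear.

Definition push_map : {linear tvec X -> tvec Y} := push.

End Push.

Fact push_map1 (X : based_space R) : push_map (germ_id X) = lin_id (tvec X).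
Proof.
apply: linear_eq => u; apply: tvec_eq => [E g|g] /=;
  by rewrite germ_comp1r.
Qed.

Fact push_mapM (X Y Z : based_space R) (g : germ Y Z) (f : germ X Y) :
  push_map (germ_comp g f) = lin_comp (push_map g) (push_map f).
Proof.
apply: linear_eq => u; apply: tvec_eq => [E h|h] /=;
  by rewrite germ_compA.
Qed.

Definition extended_tangent : functor (Dflg_loc R) (Vect R) :=
  @Functor (Dflg_loc R) (Vect R) (fun X => tvec X) push_map push_map1 push_mapM.

(** * Values on Euclidean spaces *)

Section Yoneda.
Variable E : eucl_domain R.

Definition eval_id (u : tvec (eucl_space E)) : 'rV[R]_(edim E) :=
  eucl_part u (germ_id (eucl_space E)).

Fact eval_id_linear : linear eval_id.
Proof. by []. Qed.

HB.instance Definition _ := GRing.isLinear.Build _ _ _ _ eval_id eval_id_linear.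

Program Definition tvec_of (x : 'rV[R]_(edim E)) : tvec (eucl_space E) :=
  @TVec (eucl_space E) (fun E' f => eucl_diff f x) (fun _ => 0) _ _.
Next Obligation. by move=> x E1 E2 g f /=; rewrite eucl_diffM. Qed.
Next Obligation. by []. Qed.

Fact tvec_of_linear : linear tvec_of.
Proof.
move=> a x y; apply: tvec_eq => [E' f|g] /=; first by rewrite linearP.
by rewrite scaler0 addr0.
Qed.

HB.instance Definition _ := GRing.isLinear.Build _ _ _ _ tvec_of tvec_of_linear.

(** Every germ out of [E] is its own composite with the identity of [E]. So the Euclidean part is
    determined by its value at the identity, and every germ into [two_points] factors through [E],
    which kills the extra part. *)
Lemma eval_idK : cancel eval_id tvec_of.
Proof.
move=> u; apply: tvec_eq => [E' f|g] /=.
  by rewrite -eucl_partM germ_comp1r.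
by rewrite -(germ_comp1r g) extra_part0.
Qed.

Lemma tvec_ofK : cancel tvec_of eval_id.
Proof. by move=> x; rewrite /eval_id /= eucl_diff1. Qed.

End Yoneda.

Lemma extended_tangentP : tangent_functor extended_tangent.
Proof.
have natural (E E' : eucl_domain R) (f : germ (eucl_space E) (eucl_space E')) :
    lin_comp (eval_id (E := E')) (push_map f) =
    lin_comp (eucl_diff f) (eval_id (E := E)).
  apply: linear_eq => u /=.
  by rewrite /eval_id /= -eucl_partM germ_comp1l germ_comp1r.
exists (@NatTrans _ _ (functor_restr eucl_space extended_tangent) T_Eucl
  (fun E => eval_id (E := E)) natural) => E.
exists (tvec_of (E := E) : {linear 'rV[R]_(edim E) -> tvec (eucl_space E)}); split; apply: linear_eq.
  exact: eval_idK.
exact: tvec_ofK.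
Qed.

(** * The value at the two-point space *)

Definition two_points_val (u : tvec (two_points (R := R))) : V :=
  extra_part u (germ_id two_points).

(** All germs other than the identity are constant, hence factor through R^0, and contribute
    nothing. *)
Lemma two_points_val_inj : injective two_points_val.
Proof.
move=> u v uv; apply: tvec_eq => [E f|g].
  rewrite (germ_two_points_eucl f).
  have [h [k ->]] := cst_germ_factor two_points (eucl_space E).
  by rewrite !eucl_partM [eucl_part u k]thinmx0 [eucl_part v k]thinmx0.
have [->|->] := germ_two_points g; first exact: uv.
have [h [k ->]] := @cst_germ_factor R two_points two_points.
by rewrite !extra_part0.
Qed.

Lemma two_points_val_surj (x : V) : exists u, two_points_val u = x.
Proof.
(* The extra part is supported on the identity germ alone, which never factors through a Euclidean
   space. *)
pose e (g : germ two_points (two_points (R := R))) := if `[< g = germ_id two_points >] then x else 0.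
have e0 (E : eucl_domain R) (h : germ (eucl_space E) two_points)
    (f : germ two_points (eucl_space E)) : e (germ_comp h f) = 0.
  by rewrite /e; case: asboolP => // /eucl_factor_neq_id.
have z (E E' : eucl_domain R) (g : germ (eucl_space E) (eucl_space E'))
    (f : germ two_points (eucl_space E)) : 0 = eucl_diff g 0 by rewrite linear0.
by exists (@TVec (two_points (R := R)) (fun _ _ => 0) e z e0); rewrite /two_points_val /= /e asboolT.
Qed.

End ExtendedTangent.

(** * Uncountably many isomorphism classes *)

Lemma naturally_isomorphic_bij (C : category) (R : realType)
    (F G : functor C (Vect R)) (X : C) :
  naturally_isomorphic F G -> exists f : F X -> G X, bijective f.
Proof.
move=> [eta /(_ X)[g [gf fg]]]; exists (eta X : {linear F X -> G X}).
exists (g : {linear G X -> F X}) => x.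
  exact: (congr1 (fun h : {linear F X -> F X} => h x) gf).
exact: (congr1 (fun h : {linear G X -> G X} => h x) fg).
Qed.

(** Diagonal argument: [D] collects the points [i c] lying outside [c], and injectivity makes the
    membership of [i D] in [D] contradictory. *)
Lemma Cantor_noninj (P : Type) (i : (P -> bool) -> P) : ~ injective i.
Proof.
move=> inj_i; pose D p := `[< exists2 c, i c = p & ~~ c p >].
have nD : ~~ D (i D).
  apply/negP => DD; have /asboolP[c /inj_i cD] := DD.
  by rewrite cD DD.
by move: (nD); rewrite /D asboolT//; exists D.
Qed.

(** Dedekind cuts encode reals in the small type [rat -> bool], so that the product [P] used in the
    counting argument lies in [Set]. *)
Definition rat_cut {R : realType} (x : R) (q : rat) : bool := ratr q < x.

Lemma rat_cut_inj (R : realType) : injective (@rat_cut R).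
Proof.
move=> x y; wlog xy : x y / x < y => [W|].
  by case: (ltgtP x y) => // h e; [apply: W|apply/esym/W].
have [q] := rat_in_itvoo xy; rewrite in_itv /= => /andP[xq qy].
by move=> /(congr1 (@^~ q)); rewrite /rat_cut qy ltNge (ltW xq).
Qed.

Section Family.
Variable R : realType.

Definition ext_fun (A : Set) : functor (Dflg_loc R) (Vect R) :=
  extended_tangent (A -> R^o).

Definition ext_fiber (A : Set) : Type := ext_fun A (two_points (R := R)).

(* Indexing by classes for a relation coarser than isomorphism of functors avoids
   comparing dimensions. The exponents live in [Set] because a germ contains its
   domain, so the fibers live above the universe of [set]. *)
Definition equidim (A B : Set) : Prop :=
  exists f : ext_fiber A -> ext_fiber B, bijective f.

Lemma equidim_refl A : equidim A A.
Proof. by exists id; exists id. Qed.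

Lemma equidim_sym A B : equidim A B -> equidim B A.
Proof. by move=> [f [g fK gK]]; exists g; exists f. Qed.

Lemma equidim_trans A B C : equidim A B -> equidim B C -> equidim A C.
Proof. by move=> [f bf] [g bg]; exists (g \o f); apply: bij_comp. Qed.

Definition dim_class := {K : Set -> Prop | exists A, K = equidim A}.

Definition dim_repr (K : dim_class) : Set := sval (cid (svalP K)).

Lemma dim_reprP (K : dim_class) : sval K = equidim (dim_repr K).
Proof. exact: svalP (cid (svalP K)). Qed.

Lemma dim_repr_inj (K L : dim_class) :
  equidim (dim_repr K) (dim_repr L) -> K = L.
Proof.
move=> KL; apply: eq_sig_hprop => [*|]; first exact: Prop_irrelevance.
rewrite [LHS]dim_reprP [RHS]dim_reprP.
apply/funext => A; apply/propext; split; last exact: equidim_trans.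
exact/equidim_trans/equidim_sym.
Qed.

Definition dim_class_of (A : Set) : dim_class :=
  exist _ (equidim A) (ex_intro _ A erefl).

Lemma dim_repr_of (A : Set) : equidim A (dim_repr (dim_class_of A)).
Proof. by have /= -> := dim_reprP (dim_class_of A); apply: equidim_refl. Qed.

(** Lower bound on the size of a fiber: a point of [A] is sent to a vector whose value is its
    indicator function. *)
Lemma ext_fiber_contains (A : Set) : exists i : A -> ext_fiber A, injective i.
Proof.
have /choice[i iP] : forall a : A, exists u : ext_fiber A,
    two_points_val u = fun b => (`[< b = a >])%:R.
  by move=> a; apply: two_points_val_surj.
exists i => a b /(congr1 (@two_points_val _ _)); rewrite !iP => /(congr1 (@^~ a)).
by rewrite asboolT//; case: asboolP => // _ /eqP; rewrite oner_eq0.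
Qed.

(** Upper bound on the size of a fiber: a vector is determined by a function from [A] to the reals,
    which is recorded through its cuts. *)
Lemma ext_fiber_embeds (A : Set) :
  exists i : ext_fiber A -> A -> rat -> bool, injective i.
Proof.
exists (fun u a => rat_cut (two_points_val u a)) => u v uv.
apply: two_points_val_inj; apply/funext => a.
by apply: rat_cut_inj; exact: (congr1 (@^~ a) uv).
Qed.

(** Given an enumeration [K] of the classes, the product [P] is large enough to contain every fiber.
    The power set [C] of [P] embeds in its own fiber, which is in bijection with the fiber of some
    [K n] and hence embeds in [P], against Cantor. *)
Lemma dim_class_uncountable : ~ countable [set: dim_class].
Proof.
move=> /countable_injP[f finj].
(* [K] inverts [f] on its image; outside of it the class of [unit] is an arbitrary default. *)
have /choice[K KP] : forall n, exists K, forall L, f L = n -> L = K.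
  move=> n; have [[K fK]|nK] := pselect (exists K, f K = n).
    by exists K => L fL; apply: finj; rewrite ?inE// fL.
  by exists (dim_class_of unit) => L fL; case: nK; exists L.
pose P : Set := forall n, dim_repr (K n) -> rat -> bool.
pose C : Set := P -> bool.
have [i inj_i] := ext_fiber_contains C.
have [g bg] := dim_repr_of C.
have [j inj_j] := ext_fiber_embeds (dim_repr (dim_class_of C)).
(* The class of [C] is [K n] for [n] its index, so [j] now lands in the factor [n] of [P]. *)
move: g bg j inj_j; rewrite (KP _ (dim_class_of C) erefl).
set n := f _ => g /bij_inj inj_g j inj_j.
pose F m : Type := dim_repr (K m) -> rat -> bool.
(* The factor [n] is embedded in the product by filling the other coordinates with constant
   [false]. *)
pose k (c : C) : P := @eqtype.dfwith nat F (fun _ _ _ => false) n (j (g (i c))).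
have inj_k : injective k.
  move=> c d kcd; apply: inj_i; apply: inj_g; apply: inj_j.
  by have : k c n = k d n; [rewrite kcd|rewrite /k !eqtype.dfwith_in].
exact: Cantor_noninj inj_k.
Qed.

End Family.

Theorem mainTheorem4 (R : realType) :
  exists (I : Type) (T : I -> functor (Dflg_loc R) (Vect R)),
    [/\ ~ countable [set: I],
        forall i : I, tangent_functor (T i) &
        forall i j : I, i <> j -> ~ naturally_isomorphic (T i) (T j)].
Proof.
exists (dim_class R), (fun K => ext_fun R (dim_repr K)); split.
- exact: dim_class_uncountable.
- by move=> K; apply: extended_tangentP.
(* A natural isomorphism, evaluated at [two_points], gives a bijection of fibers, so that the two
   classes coincide. *)
- move=> K L KL /(@naturally_isomorphic_bij _ _ _ _ (two_points (R := R))).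
  by move=> /dim_repr_inj.
Qed.
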